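(* Let $V_1, V_2, \dots, V_t : S^{m-1} \to S^{m-1}$ be bistochastic operators and let $\lambda_1, \lambda_2, \dots, \lambda_t$ be positive numbers with $\sum_{i=1}^t \lambda_i = 1$. Then the following statements hold: (i) $\mathrm{Fix}\big(\sum_{i=1}^t \lambda_i V_i\big) = \bigcap_{i=1}^t \mathrm{Fix}(V_i)$. (ii) $\mathrm{Per}_p\big(\sum_{i=1}^t \lambda_i V_i\big) \subset \bigcap_{i=1}^t \mathrm{Per}_p(V_i)$ for all $p \in \mathbb{N}$, $p\ge 1$. (iii) In general, the converse of (ii) does not hold: there exist $m$, $t$, $p$, bistochastic operators $V_1, \dots, V_t$ on $S^{m-1}$ and positive numbers $\lambda_1, \dots, \lambda_t$ with $\sum_{i=1}^t \lambda_i = 1$ such that $\bigcap_{i=1}^t \mathrm{Per}_p(V_i) \not\subset \mathrm{Per}_p\big(\sum_{i=1}^t \lambda_i V_i\big)$.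
   Context: $S^{m-1} = \{x = (x_1, \dots, x_m) \in \mathbb{R}^m : \sum_{i=1}^m x_i = 1,\ x_i \ge 0\}$ is the standard simplex. For $x \in S^{m-1}$, let $x_{[1]} \ge x_{[2]} \ge \dots \ge x_{[m]}$ be the coordinates of $x$ arranged in non-increasing order. For $x, y \in S^{m-1}$ write $x \prec y$ ($y$ majorizes $x$) if $\sum_{i=1}^k x_{[i]} \le \sum_{i=1}^k y_{[i]}$ for $k = 1, \dots, m-1$. A stochastic operator is a continuous map $V : S^{m-1} \to S^{m-1}$ (not necessarily linear or quadratic); it is called bistochastic if $V(x) \prec x$ for all $x \in S^{m-1}$. Convex combinations of operators are taken pointwise: $\big(\sum_i \lambda_i V_i\big)(x) = \sum_i \lambda_i V_i(x)$. $\mathrm{Fix}(V)$ is the set of fixed points of $V$, and $\mathrm{Per}_p(V)$ is the set of periodic points of $V$ of prime (i.e. least) period $p$. *)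

(* Defs.v *)
From HB Require Import structures.
From mathcomp Require Import all_boot all_order all_algebra.
From mathcomp Require Import all_classical all_reals all_analysis.

Set Implicit Arguments.
Unset Strict Implicit.
Unset Printing Implicit Defensive.

Import Order.TTheory GRing.Theory Num.Theory.
Import numFieldNormedType.Exports.

Local Open Scope classical_set_scope.
Local Open Scope ring_scope.

Definition simplex (R : realType) (m : nat) : set 'rV[R]_m :=
  [set x | \sum_(i < m) x ord0 i = 1 /\ forall i : 'I_m, 0 <= x ord0 i].
Arguments simplex : clear implicits.

(* The coordinates in non-increasing order; indices start at 0, so that
   [decr x i] is $x_{[i+1]}$. *)
Definition decr (R : realType) (m : nat) (x : 'rV[R]_m) (i : nat) : R :=
  nth 0 (sort >=%R [seq x ord0 j | j <- enum 'I_m]) i.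

(* [majorized x y] is $x \prec y$. The equality of the total sums is not
   required here because both vectors are meant to lie in the simplex. *)
Definition majorized (R : realType) (m : nat) (x y : 'rV[R]_m) : Prop :=
  forall k : nat, (1 <= k <= m.-1)%N ->
    \sum_(i < k) decr x i <= \sum_(i < k) decr y i.

(* Operators on the simplex are represented by functions on the ambient space;
   every notion below only depends on their values on the simplex. *)
Definition stochastic (R : realType) (m : nat)
    (V : 'rV[R]_m -> 'rV[R]_m) : Prop :=
  set_fun (simplex R m) (simplex R m) V /\
  {within simplex R m, continuous V}.

Definition bistochastic (R : realType) (m : nat)
    (V : 'rV[R]_m -> 'rV[R]_m) : Prop :=
  stochastic V /\ forall x, simplex R m x -> majorized (V x) x.

Definition convex_comb (R : realType) (m t : nat) (lambda : 'I_t -> R)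
    (V : 'I_t -> 'rV[R]_m -> 'rV[R]_m) : 'rV[R]_m -> 'rV[R]_m :=
  fun x => \sum_(i < t) lambda i *: V i x.

Definition Fix (R : realType) (m : nat) (V : 'rV[R]_m -> 'rV[R]_m) :
    set 'rV[R]_m :=
  [set x | simplex R m x /\ V x = x].

Definition Per (R : realType) (m p : nat) (V : 'rV[R]_m -> 'rV[R]_m) :
    set 'rV[R]_m :=
  [set x | [/\ simplex R m x, iter p V x = x
             & forall q : nat, (0 < q < p)%N -> iter q V x <> x]].

(* Main.v *)
Require Import Defs.
From HB Require Import structures.
From mathcomp Require Import all_boot all_order all_algebra.
From mathcomp Require Import all_classical all_reals all_analysis.
From mathcomp Require Import perm ring lra.

Set Implicit Arguments.
Unset Strict Implicit.
Unset Printing Implicit Defensive.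

Import Order.TTheory GRing.Theory Num.Theory.
Import numFieldNormedType.Exports.

Local Open Scope classical_set_scope.
Local Open Scope ring_scope.

(** A bistochastic operator does not increase the Euclidean length of a point of
    the simplex, because the sum of squares is Schur-convex
    ([majorized_sum_sqr]).  Let $W = \sum_i \lambda_i V_i$.  The weighted
    variance of the points $V_i(x)$ is
      $\sum_i \lambda_i |V_i(x) - W(x)|^2
         = \sum_i \lambda_i |V_i(x)|^2 - |W(x)|^2 \le |x|^2 - |W(x)|^2$
    ([convex_comb_sum_sqr]).  Hence $W$ does not increase the length either, and
    if $W$ preserves the length of $x$ then all the $V_i(x)$ coincide with
    $W(x)$ ([convex_comb_rigid]).

    Along a periodic orbit of $W$ the length is nonincreasing and periodic,
    hence constant, so every $V_i$ agrees with $W$ on the whole orbit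
    ([periodic_orbit_agree]).  This yields (ii), and (i) is the case of period
    one together with the fact that a common fixed point of the $V_i$ is fixed
    by their convex combinations.

    The same rigidity gives (iii): it is enough to find two operators with a
    common point of prime period $p$ at which they take different values.  On
    the triangle, two reflections that move the vertex $(1, 0, 0)$ to the two
    other vertices have this property with $p = 2$. *)

(** * Schur-convexity of the sum of squares *)

Lemma size_decr (R : realType) (m : nat) (x : 'rV[R]_m) :
  size (sort >=%R [seq x ord0 j | j <- enum 'I_m]) = m.
Proof. by rewrite size_sort size_map size_enum_ord. Qed.

Lemma sum_decr (R : realType) (m : nat) (f : R -> R) (x : 'rV[R]_m) :
  \sum_(i < m) f (decr x i) = \sum_(i < m) f (x ord0 i).
Proof.
rewrite -(big_mkord xpredT (fun i => f (decr x i))) -{1}(size_decr x).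
rewrite -(big_nth 0 xpredT f).
rewrite (perm_big [seq x ord0 j | j <- enum 'I_m]) /=.
  by rewrite big_map big_enum.
by apply/permPl; exact: perm_sort.
Qed.

Lemma decr_nonincreasing (R : realType) (m : nat) (x : 'rV[R]_m) (i : nat) :
  (i.+1 < m)%N -> decr x i.+1 <= decr x i.
Proof.
move=> im; rewrite /decr.
have ge_tr : transitive (>=%R : rel R).
  by move=> b a c /= ba cb; exact: le_trans cb ba.
apply: (sorted_ltn_nth ge_tr 0) => //; rewrite ?inE ?size_decr //.
  by apply: sort_sorted => a b; rewrite /= le_total.
exact: ltnW.
Qed.

(** Summation by parts, as an induction: replacing $a_n$ by the smaller
    $a_{n+1}$ as the common lower factor only loses a multiple of the
    nonnegative partial sum of [d]. *)
Lemma abel_sum_lower (R : realType) (n : nat) (a d : nat -> R) :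
  (forall i, (i < n)%N -> a i.+1 <= a i) ->
  (forall k, (k <= n)%N -> 0 <= \sum_(i < k) d i) ->
  a n * \sum_(i < n.+1) d i <= \sum_(i < n.+1) a i * d i.
Proof.
elim: n => [|n IHn] a_dec d_ge0; first by rewrite !big_ord1.
rewrite [X in _ * X]big_ord_recr [X in _ <= X]big_ord_recr /= mulrDr lerD2r.
apply: (@le_trans _ _ (a n * \sum_(i < n.+1) d i)).
  by apply: ler_wpM2r; [exact: d_ge0 | exact: a_dec].
by apply: IHn => [i lt_in | k le_kn]; [apply: a_dec | apply: d_ge0]; exact: leqW.
Qed.

(** Tangent-line argument for the square: with $a$, $b$ the rearrangements of
    [x] and [y], $\sum b_i^2 - \sum a_i^2 \ge 2 \sum a_i (b_i - a_i)$, and the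
    right-hand side is nonnegative by summation by parts because the total of
    $b - a$ is zero. *)
Lemma majorized_sum_sqr (R : realType) (m : nat) (x y : 'rV[R]_m) :
  simplex R m x -> simplex R m y -> majorized x y ->
  \sum_(i < m) x ord0 i ^+ 2 <= \sum_(i < m) y ord0 i ^+ 2.
Proof.
case: m x y => [|m] x y [sum_x _] [sum_y _] maj_xy; first by rewrite !big_ord0.
have diff_ge0 k : (k <= m)%N -> 0 <= \sum_(i < k) (decr y i - decr x i).
  case: k => [|k] le_km; first by rewrite big_ord0.
  by rewrite sumrB subr_ge0; apply: maj_xy.
have := abel_sum_lower (d := fun i => decr y i - decr x i)
          (@decr_nonincreasing _ _ x) diff_ge0.
have -> : \sum_(i < m.+1) (decr y i - decr x i) = 0.
  by rewrite sumrB !(sum_decr id) sum_x sum_y subrr.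
rewrite mulr0 => abel.
rewrite -!(sum_decr (fun r => r ^+ 2)) -subr_ge0 -sumrB.
apply: (@le_trans _ _ (2 * \sum_(i < m.+1) decr x i * (decr y i - decr x i))).
  by apply: mulr_ge0.
rewrite mulr_sumr; apply: ler_sum => i _.
by rewrite -subr_ge0; have := sqr_ge0 (decr y i - decr x i); lra.
Qed.

(** * Rigidity of convex combinations *)

Lemma weighted_variance (R : realType) (t : nat) (lambda u : 'I_t -> R) :
  \sum_(i < t) lambda i = 1 ->
  \sum_(i < t) lambda i * (u i - \sum_(j < t) lambda j * u j) ^+ 2
  = \sum_(i < t) lambda i * u i ^+ 2 - (\sum_(j < t) lambda j * u j) ^+ 2.
Proof.
move=> sum1; set w := \sum_(j < t) lambda j * u j.
transitivity (\sum_(i < t) (lambda i * u i ^+ 2 - 2 * w * (lambda i * u i)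
                            + w ^+ 2 * lambda i)).
  by apply: eq_bigr => i _; ring.
rewrite big_split /= sumrB -!mulr_sumr sum1 -/w; ring.
Qed.

Lemma convex_comb_coord (R : realType) (m t : nat) (lambda : 'I_t -> R)
    (V : 'I_t -> 'rV[R]_m -> 'rV[R]_m) (x : 'rV[R]_m) (j : 'I_m) :
  convex_comb lambda V x ord0 j = \sum_(i < t) lambda i * V i x ord0 j.
Proof. by rewrite summxE; apply: eq_bigr => i _; rewrite mxE. Qed.

Lemma simplex_convex_comb (R : realType) (m t : nat) (lambda : 'I_t -> R)
    (V : 'I_t -> 'rV[R]_m -> 'rV[R]_m) (x : 'rV[R]_m) :
  (forall i, 0 <= lambda i) -> \sum_(i < t) lambda i = 1 ->
  (forall i, simplex R m (V i x)) -> simplex R m (convex_comb lambda V x).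
Proof.
move=> lambda_ge0 sum1 Vx; split=> [|j].
  under eq_bigr do rewrite convex_comb_coord.
  rewrite exchange_big /= -sum1; apply: eq_bigr => i _.
  by rewrite -mulr_sumr (Vx i).1 mulr1.
rewrite convex_comb_coord; apply: sumr_ge0 => i _.
by apply: mulr_ge0; [exact: lambda_ge0 | exact: (Vx i).2].
Qed.

Lemma bistochastic_sum_sqr (R : realType) (m : nat)
    (V : 'rV[R]_m -> 'rV[R]_m) (x : 'rV[R]_m) :
  bistochastic V -> simplex R m x ->
  \sum_(j < m) V x ord0 j ^+ 2 <= \sum_(j < m) x ord0 j ^+ 2.
Proof.
move=> [[V_simplex _] V_maj] sx.
by apply: majorized_sum_sqr => //; [exact: V_simplex | exact: V_maj].
Qed.

(** This is the variance identity summed over the coordinates, where each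
    $|V_i(x)|^2$ has been bounded by $|x|^2$. *)
Lemma convex_comb_sum_sqr (R : realType) (m t : nat) (lambda : 'I_t -> R)
    (V : 'I_t -> 'rV[R]_m -> 'rV[R]_m) (x : 'rV[R]_m) :
  (forall i, bistochastic (V i)) -> (forall i, 0 <= lambda i) ->
  \sum_(i < t) lambda i = 1 -> simplex R m x ->
  \sum_(j < m) \sum_(i < t)
      lambda i * (V i x ord0 j - convex_comb lambda V x ord0 j) ^+ 2
  <= \sum_(j < m) x ord0 j ^+ 2
     - \sum_(j < m) convex_comb lambda V x ord0 j ^+ 2.
Proof.
move=> V_bist lambda_ge0 sum1 sx.
under eq_bigr do rewrite convex_comb_coord weighted_variance // -convex_comb_coord.
rewrite sumrB lerD2r exchange_big /=.
rewrite -[leRHS]mul1r -sum1 mulr_suml; apply: ler_sum => i _.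
by rewrite -mulr_sumr; apply: ler_wpM2l => //; exact: bistochastic_sum_sqr.
Qed.

Lemma convex_comb_sum_sqr_le (R : realType) (m t : nat) (lambda : 'I_t -> R)
    (V : 'I_t -> 'rV[R]_m -> 'rV[R]_m) (x : 'rV[R]_m) :
  (forall i, bistochastic (V i)) -> (forall i, 0 <= lambda i) ->
  \sum_(i < t) lambda i = 1 -> simplex R m x ->
  \sum_(j < m) convex_comb lambda V x ord0 j ^+ 2
  <= \sum_(j < m) x ord0 j ^+ 2.
Proof.
move=> V_bist lambda_ge0 sum1 sx; rewrite -subr_ge0.
apply: le_trans (convex_comb_sum_sqr V_bist lambda_ge0 sum1 sx).
apply: sumr_ge0 => j _; apply: sumr_ge0 => i _.
by apply: mulr_ge0 => //; exact: sqr_ge0.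
Qed.

(** If the length does not drop, the weighted variance of the $V_i(x)$ is zero,
    and positivity of the weights forces each deviation to vanish. *)
Lemma convex_comb_rigid (R : realType) (m t : nat) (lambda : 'I_t -> R)
    (V : 'I_t -> 'rV[R]_m -> 'rV[R]_m) (x : 'rV[R]_m) :
  (forall i, bistochastic (V i)) -> (forall i, 0 < lambda i) ->
  \sum_(i < t) lambda i = 1 -> simplex R m x ->
  \sum_(j < m) x ord0 j ^+ 2
    <= \sum_(j < m) convex_comb lambda V x ord0 j ^+ 2 ->
  forall i, V i x = convex_comb lambda V x.
Proof.
move=> V_bist lambda_gt0 sum1 sx; rewrite -subr_le0 => no_drop i.
have lambda_ge0 k : 0 <= lambda k by exact: ltW.
have term_ge0 j k :
    0 <= lambda k * (V k x ord0 j - convex_comb lambda V x ord0 j) ^+ 2.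
  by apply: mulr_ge0 => //; exact: sqr_ge0.
have row_ge0 j : true -> 0 <= \sum_(k < t)
    lambda k * (V k x ord0 j - convex_comb lambda V x ord0 j) ^+ 2.
  by move=> _; apply: sumr_ge0.
have := le_trans (convex_comb_sum_sqr V_bist lambda_ge0 sum1 sx) no_drop.
rewrite le_eqVlt ltNge sumr_ge0 ?orbF //.
rewrite psumr_eq0 // => /allP var0; apply/rowP => j.
have := var0 j (mem_index_enum _); rewrite psumr_eq0 // => /allP/(_ i).
rewrite mem_index_enum mulf_eq0 gt_eqF //= sqrf_eq0 subr_eq0.
by move=> /(_ isT)/eqP.
Qed.

(** * Periodic orbits *)

(** The lengths along the orbit form a nonincreasing sequence which returns to
    its value after [p] steps, so no step decreases the length and rigidity
    applies at every point of the orbit. *)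
Lemma periodic_orbit_agree (R : realType) (m t p : nat) (lambda : 'I_t -> R)
    (V : 'I_t -> 'rV[R]_m -> 'rV[R]_m) (x : 'rV[R]_m) :
  (forall i, bistochastic (V i)) -> (forall i, 0 < lambda i) ->
  \sum_(i < t) lambda i = 1 -> simplex R m x ->
  (0 < p)%N -> iter p (convex_comb lambda V) x = x ->
  forall (i : 'I_t) (k : nat), iter k (V i) x = iter k (convex_comb lambda V) x.
Proof.
set W := convex_comb lambda V => V_bist lambda_gt0 sum1 sx p_gt0 Wpx i.
have lambda_ge0 k : 0 <= lambda k by exact: ltW.
have orbit_simplex k : simplex R m (iter k W x).
  elim: k => //= k IHk; apply: simplex_convex_comb => // j.
  exact: (V_bist j).1.1.
pose len k := \sum_(j < m) iter k W x ord0 j ^+ 2.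
have len_dec : {homo len : k l / (k <= l)%N >-> l <= k}.
  by apply/nonincreasing_seqP => k;
    exact: (convex_comb_sum_sqr_le V_bist lambda_ge0 sum1 (orbit_simplex k)).
have len_per k : len (k + p)%N = len k by rewrite /len iterD Wpx.
have agree k : V i (iter k W x) = W (iter k W x).
  apply: (convex_comb_rigid V_bist lambda_gt0 sum1 (orbit_simplex k)).
  rewrite -/(len k) -len_per; apply: (len_dec k.+1).
  by rewrite -addn1 leq_add2l.
by elim=> //= k ->.
Qed.

Lemma Per_convex_comb_sub (R : realType) (m t p : nat) (lambda : 'I_t -> R)
    (V : 'I_t -> 'rV[R]_m -> 'rV[R]_m) :
  (forall i, bistochastic (V i)) -> (forall i, 0 < lambda i) ->
  \sum_(i < t) lambda i = 1 -> (0 < p)%N ->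
  Per p (convex_comb lambda V) `<=` \bigcap_(i in [set: 'I_t]) Per p (V i).
Proof.
move=> V_bist lambda_gt0 sum1 p_gt0 x [sx Wpx W_prime] i _.
have agree := periodic_orbit_agree V_bist lambda_gt0 sum1 sx p_gt0 Wpx i.
by split=> [//||q /W_prime]; rewrite agree.
Qed.

Lemma Per1 (R : realType) (m : nat) (V : 'rV[R]_m -> 'rV[R]_m) :
  Per 1 V = Fix V.
Proof.
apply/seteqP; split=> x; first by case.
by case=> sx Vx; split=> // -[].
Qed.

Lemma Fix_convex_comb (R : realType) (m t : nat) (lambda : 'I_t -> R)
    (V : 'I_t -> 'rV[R]_m -> 'rV[R]_m) :
  (forall i, bistochastic (V i)) -> (forall i, 0 < lambda i) ->
  \sum_(i < t) lambda i = 1 ->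
  Fix (convex_comb lambda V) = \bigcap_(i in [set: 'I_t]) Fix (V i).
Proof.
move=> V_bist lambda_gt0 sum1; apply/seteqP; split=> x.
  rewrite -Per1 => /(Per_convex_comb_sub V_bist lambda_gt0 sum1 (ltn0Sn 0)) Vx i _.
  by rewrite -Per1; exact: Vx.
move=> Vx; case: t => [|t] in lambda V V_bist lambda_gt0 sum1 Vx *.
  (* An empty family has no weights of total one. *)
  by move/eqP: sum1; rewrite big_ord0 eq_sym oner_eq0.
split; first exact: (Vx ord0 I).1.
rewrite /convex_comb; under eq_bigr => i _ do rewrite (Vx i I).2.
by rewrite -scaler_suml sum1 scale1r.
Qed.

(** * Permutation operators and the counterexample *)

Lemma col_perm_continuous (R : realType) (m : nat) (s : {perm 'I_m}) :
  continuous (col_perm s : 'rV[R]_m -> 'rV[R]_m).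
Proof.
(* Neighborhoods of a matrix are the products of neighborhoods of its entries. *)
move=> x A [B nbhsB subA].
exists (fun i j => B i (s^-1 j)%g) => [i j|y By].
  by have := nbhsB i (s^-1 j)%g; rewrite mxE permKV.
by apply: subA => i j; have := By i (s j); rewrite /= mxE permK.
Qed.

Lemma simplex_col_perm (R : realType) (m : nat) (s : {perm 'I_m}) (x : 'rV[R]_m) :
  simplex R m x -> simplex R m (col_perm s x).
Proof.
move=> [sum_x x_ge0]; split=> [|j]; last by rewrite mxE.
rewrite -sum_x [RHS](reindex_inj (@perm_inj _ s)) /=.
by apply: eq_bigr => j _; rewrite mxE.
Qed.

Lemma decr_col_perm (R : realType) (m : nat) (s : {perm 'I_m}) (x : 'rV[R]_m) :
  decr (col_perm s x) = decr x.
Proof.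
rewrite /decr; congr (fun u => nth 0 u).
apply/perm_sortP => [a b | b a c /= ba cb | a b |].
- by rewrite /= le_total.
- exact: le_trans cb ba.
- by move=> /andP[ba ab]; apply: le_anti; apply/andP; split.
have -> : [seq col_perm s x ord0 j | j <- enum 'I_m]
    = [seq x ord0 j | j <- map s (enum 'I_m)].
  by rewrite -[RHS]map_comp; apply/eq_in_map => j _; rewrite /= mxE.
apply: perm_map; apply: uniq_perm; rewrite ?enum_uniq //.
  by rewrite map_inj_uniq ?enum_uniq //; exact: perm_inj.
move=> j; rewrite mem_enum; apply/mapP; exists (s^-1 j)%g; rewrite ?mem_enum //.
by rewrite permKV.
Qed.

Lemma bistochastic_col_perm (R : realType) (m : nat) (s : {perm 'I_m}) :
  bistochastic (col_perm s : 'rV[R]_m -> 'rV[R]_m).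
Proof.
split; first split.
- by move=> x; exact: simplex_col_perm.
- by apply: continuous_subspaceT; exact: col_perm_continuous.
- by move=> x _ k _; rewrite decr_col_perm.
Qed.

Lemma simplex_vertex (R : realType) (m : nat) (j : 'I_m) :
  simplex R m (delta_mx ord0 j).
Proof.
split=> [|k]; last by rewrite mxE ler0n.
rewrite (bigD1 j) //= big1 ?addr0 ?mxE ?eqxx //.
by move=> k kj; rewrite mxE (negPf kj) andbF.
Qed.

Lemma Per2_vertex_tperm (R : realType) (m : nat) (j k : 'I_m) :
  j != k ->
  Per 2 (col_perm (tperm j k)) (delta_mx ord0 j : 'rV[R]_m).
Proof.
move=> jk; split=> [||[|[|//]] // _]; first exact: simplex_vertex.
  by rewrite /= -col_permM tperm2 col_perm1.
move=> /rowP/(_ j); rewrite !mxE tpermL !eqxx eq_sym (negPf jk) /= => /eqP.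
by rewrite eq_sym oner_eq0.
Qed.

Theorem theorem3p2 (R : realType) :
  (forall (m t : nat) (V : 'I_t -> 'rV[R]_m -> 'rV[R]_m) (lambda : 'I_t -> R),
     (0 < m)%N ->
     (forall i : 'I_t, bistochastic (V i)) ->
     (forall i : 'I_t, 0 < lambda i) ->
     \sum_(i < t) lambda i = 1 ->
     Fix (convex_comb lambda V) = \bigcap_(i in [set: 'I_t]) Fix (V i) /\
     (forall p : nat, (1 <= p)%N ->
        Per p (convex_comb lambda V)
          `<=` \bigcap_(i in [set: 'I_t]) Per p (V i))) /\
  (exists (m t p : nat) (V : 'I_t -> 'rV[R]_m -> 'rV[R]_m)
          (lambda : 'I_t -> R),
     [/\ (0 < m)%N /\ (1 <= p)%N,
         forall i : 'I_t, bistochastic (V i),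
         forall i : 'I_t, 0 < lambda i,
         \sum_(i < t) lambda i = 1
       & ~ (\bigcap_(i in [set: 'I_t]) Per p (V i)
              `<=` Per p (convex_comb lambda V))]).
Proof.
split=> [m t V lambda _ V_bist lambda_gt0 sum1 |].
  split=> [|p p_gt0]; first exact: Fix_convex_comb.
  exact: Per_convex_comb_sub.
pose V (i : 'I_2) : 'rV[R]_3 -> 'rV[R]_3 :=
  col_perm (tperm ord0 (lift ord0 i)).
have V_bist i : bistochastic (V i) by exact: bistochastic_col_perm.
have half_gt0 (i : 'I_2) : 0 < 2^-1 :> R by rewrite invr_gt0 ltr0n.
have sum_half : \sum_(i < 2) 2^-1 = 1 :> R.
  by rewrite sumr_const card_ord -[LHS]mulr_natl divff ?pnatr_eq0.
exists 3%N, 2%N, 2%N, V, (fun _ => 2^-1); split=> //.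
pose e : 'rV[R]_3 := delta_mx ord0 ord0.
move=> /(_ e)[i _|se We _]; first exact: Per2_vertex_tperm.
(* Rigidity would make the two reflections agree at the vertex. *)
have agree := periodic_orbit_agree V_bist half_gt0 sum_half se (ltn0Sn 1) We.
have /rowP/(_ (lift ord0 ord0)) : V ord0 e = V ord_max e.
  by have := agree ord0 1%N; rewrite -(agree ord_max 1%N).
by rewrite !mxE tpermR tpermD //= => /eqP; rewrite oner_eq0.
Qed.
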